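(* Let $t>2$ be a natural number, $n=2t+1$, and let $W=2^t+2+1$ be the Welch exponent. Then $W$ and $e(3,i)$ never lie in the same cyclotomic coset modulo $2^n-1$ for any $0<i<n$; i.e., there is no natural number $a$ with $2^a e(3,i)\equiv W\pmod{2^n-1}$.
   Context: For natural numbers $l,k$, $e(l,k)=\sum_{j=0}^{l-1}2^{jk}$. The cyclotomic coset of $d$ modulo $2^n-1$ is $\{2^a d \bmod (2^n-1): a\ge 0\}$. *)

(* Defs.v *)
From mathcomp Require Import all_boot.

Set Implicit Arguments.
Unset Strict Implicit.
Unset Printing Implicit Defensive.

Definition e (l k : nat) : nat := \sum_(j < l) 2 ^ (j * k).

Definition welch (t : nat) : nat := 2 ^ t + 2 + 1.

Definition cyclotomic_coset (n d : nat) : nat -> Prop :=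
  fun x => exists a : nat, x = (2 ^ a * d) %% (2 ^ n - 1).

(* Cosets consist of reduced residues, whereas x and y (for instance e 3 i) may
   exceed the modulus; hence membership is tested on the residues of x and y. *)
Definition same_cyclotomic_coset (n x y : nat) : Prop :=
  exists d : nat,
    cyclotomic_coset n d (x %% (2 ^ n - 1)) /\
    cyclotomic_coset n d (y %% (2 ^ n - 1)).

(* Main.v *)
Require Import Defs.
From mathcomp Require Import all_boot.
From mathcomp Require Import zify.

(** Modulo [2 ^ n - 1] the exponents of powers of two only matter modulo [n].
    As [n] is odd and [0 < i < n], the residues of [a], [a + i], [a + 2 * i] are
    distinct, so uniqueness of binary expansions makes them a permutation of
    [0], [1], [t]; but no ordering of these is an arithmetic progression
    modulo [2 * t + 1] when [2 < t]. *)

Lemma expn2_mod_pred n a : 2 ^ a = 2 ^ (a %% n) %[mod 2 ^ n - 1].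
Proof.
have h1 : 2 ^ n = 1 %[mod 2 ^ n - 1].
  by rewrite -{1}(subnK (expn_gt0 2 n)) modnDl.
rewrite {1}(divn_eq a n) expnD [_ * n]mulnC expnM -modnMml -modnXm h1.
by rewrite modnXm exp1n modnMml mul1n.
Qed.

(** As [1 < t], the right side is 3 modulo 4: oddness forces [p = 0], then the residue modulo 4
    forces [q = 1], and cancelling leaves [2 ^ r = 2 ^ t]. *)
Lemma expn2_add3_sorted t p q r : 1 < t -> p < q -> q < r ->
  2 ^ p + 2 ^ q + 2 ^ r = 2 ^ t + 2 + 1 -> [/\ p = 0, q = 1 & r = t].
Proof.
case: t => [|[|t]] // _; case: q => // q; case: r => // r.
case: p => [_|p]; last by rewrite !expnS; lia.
case: q => [_|q]; last by case: r => // r; rewrite !expnS; lia.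
move=> h; split=> //; apply/eqP.
by rewrite -(eqn_exp2l _ _ (ltnSn 1)); apply/eqP; move: h; rewrite expn0 expn1; lia.
Qed.

(** Each power is at most half of the next, so the sum is at most [2 ^ n - 2 ^ p]. *)
Lemma expn2_add3_le n p q r : p < q -> q < r -> r < n ->
  2 ^ p + 2 ^ q + 2 ^ r <= 2 ^ n - 1.
Proof.
move=> pq qr rn.
have h x y : x < y -> 2 * 2 ^ x <= 2 ^ y by move=> xy; rewrite -expnS leq_exp2l.
by move: (h _ _ pq) (h _ _ qr) (h _ _ rn) (expn_gt0 2 p); lia.
Qed.

Lemma expn2_add3_mod_sorted n t p q r : 1 < t -> t.+1 < n ->
  p < q -> q < r -> r < n ->
  2 ^ p + 2 ^ q + 2 ^ r = 2 ^ t + 2 + 1 %[mod 2 ^ n - 1] ->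
  [/\ p = 0, q = 1 & r = t].
Proof.
move=> t1 tn pq qr rn.
have hW : 2 ^ t + 2 + 1 < 2 ^ n - 1.
  have : 2 ^ t.+2 <= 2 ^ n by rewrite leq_exp2l.
  have : 2 ^ 2 <= 2 ^ t by rewrite leq_exp2l.
  by rewrite !expnS expn0; lia.
rewrite (modn_small hW).
have := expn2_add3_le _ _ _ _ pq qr rn.
(* A sum equal to the modulus would reduce to 0, but the right side is positive. *)
rewrite leq_eqVlt => /orP[/eqP ->|h]; first by rewrite modnn; lia.
by rewrite (modn_small h); exact: expn2_add3_sorted.
Qed.

Lemma expn2_geom3_neq_welch t n i a : 2 < t -> n = 2 * t + 1 -> 0 < i < n ->
  2 ^ a * e 3 i <> welch t %[mod 2 ^ n - 1].
Proof.
move=> ht hn hi; rewrite /e /welch !big_ord_recr big_ord0 /= add0n mul0n mul1n.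
rewrite !mulnDr -!expnD addn0.
pose p := a %% n; pose q := (a + i) %% n; pose r := (a + 2 * i) %% n.
have E : 2 ^ a + 2 ^ (a + i) + 2 ^ (a + 2 * i)
         = 2 ^ p + 2 ^ q + 2 ^ r %[mod 2 ^ n - 1].
  rewrite -modnDm -[in LHS](modnDm (2 ^ a)).
  by rewrite (expn2_mod_pred n a) (expn2_mod_pred n (a + i))
             (expn2_mod_pred n (a + 2 * i)) modnDm -modnDml modnDm modnDml.
rewrite E => {E}.
have n0 : 0 < n by lia.
have pn : p < n by rewrite ltn_mod.
have qE : q = p + i \/ q + n = p + i.
  rewrite /q -modnDml -/p; case: (ltnP (p + i) n) => h.
    by left; rewrite modn_small.
  by right; rewrite -[p + i](subnK h) modnDr modn_small; lia.
have qn : q < n by rewrite ltn_mod.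
have rE : r = q + i \/ r + n = q + i.
  rewrite /r mul2n -addnn addnA -modnDml -/q; case: (ltnP (q + i) n) => h.
    by left; rewrite modn_small.
  by right; rewrite -[q + i](subnK h) modnDr modn_small; lia.
have rn : r < n by rewrite ltn_mod.
clearbody p q r.
(* [q] is the middle term of the progression modulo [n]. *)
have N : p + r = 2 * q \/ p + r = 2 * q + n \/ p + r + n = 2 * q by lia.
have npq : p <> q by lia.
have nqr : q <> r by lia.
(* Equality would make [n] divide [2 * i], hence [2 * i = n], but [n] is odd. *)
have npr : p <> r by lia.
have S x y z := @expn2_add3_mod_sorted n t x y z ltac:(lia) ltac:(lia).
move=> h.
have h1 : 2 ^ p + 2 ^ r + 2 ^ q = 2 ^ t + 2 + 1 %[mod 2 ^ n - 1] by rewrite addnAC.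
have h2 : 2 ^ q + 2 ^ p + 2 ^ r = 2 ^ t + 2 + 1 %[mod 2 ^ n - 1].
  by rewrite (addnC (2 ^ q)).
have h3 : 2 ^ q + 2 ^ r + 2 ^ p = 2 ^ t + 2 + 1 %[mod 2 ^ n - 1] by rewrite addnAC.
have h4 : 2 ^ r + 2 ^ p + 2 ^ q = 2 ^ t + 2 + 1 %[mod 2 ^ n - 1].
  by rewrite (addnC (2 ^ r)).
have h5 : 2 ^ r + 2 ^ q + 2 ^ p = 2 ^ t + 2 + 1 %[mod 2 ^ n - 1] by rewrite addnAC.
(* Each of the six orders sorts the exponents to 0, 1, [t]. For [q] equal to 0, 1 or [t], [N] makes
   [n] divide [t + 1], [t - 2] or [2 * t - 1], all strictly between 0 and [n] since [2 < t]. *)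
case: (ltngtP p q) => pq; last by [].
  case: (ltngtP q r) => qr; last by [].
    by have [] := S _ _ _ pq qr rn h; move: N hn ht; clear; lia.
  case: (ltngtP p r) => pr; last by [].
    by have [] := S _ _ _ pr qr qn h1; move: N hn ht; clear; lia.
  by have [] := S _ _ _ pr pq qn h4; move: N hn ht; clear; lia.
case: (ltngtP p r) => pr; last by [].
  by have [] := S _ _ _ pq pr rn h2; move: N hn ht; clear; lia.
case: (ltngtP q r) => qr; last by [].
  by have [] := S _ _ _ qr pr pn h3; move: N hn ht; clear; lia.
by have [] := S _ _ _ qr pq pn h5; move: N hn ht; clear; lia.
Qed.

(** Powers of 2 are invertible modulo [2 ^ n - 1], so the common representative [d] can be
    eliminated. *)
Lemma same_cyclotomic_cosetP n x y : 0 < n -> same_cyclotomic_coset n x y ->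
  exists a, 2 ^ a * y = x %[mod 2 ^ n - 1].
Proof.
move=> n0 [d [[a ha] [b hb]]].
(* [n * b - b] plays the role of the exponent [- b] modulo [n]. *)
exists (a + (n * b - b)).
rewrite ha -modnMmr hb modnMmr mulnA -expnD -addnA subnK; last exact: leq_pmull.
rewrite -modnMml (expn2_mod_pred n) [n * b]mulnC [a + _]addnC modnMDl.
by rewrite -expn2_mod_pred modnMml.
Qed.

Theorem theorem2 (t n : nat) (ht : 2 < t) (hn : n = 2 * t + 1) :
  forall i : nat, 0 < i < n ->
    ~ same_cyclotomic_coset n (welch t) (e 3 i) /\
    ~ (exists a : nat, 2 ^ a * e 3 i = welch t %[mod 2 ^ n - 1]).
Proof.
move=> i hi.
have H : ~ (exists a : nat, 2 ^ a * e 3 i = welch t %[mod 2 ^ n - 1]).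
  by move=> [a]; exact: expn2_geom3_neq_welch.
by split=> // /same_cyclotomic_cosetP H0; apply/H/H0; rewrite hn addn1.
Qed.
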